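(* Let $G$ be a graph. Then $G$ satisfies the weak square condition (WSC) if and only if $G$ is a domain.
   Context: Graphs are finite, simple, undirected, with vertex set $\{1,\dots,n\}$, $n\ge 1$. $\mathbb{N}$ denotes the nonnegative integers. For $k\in\mathbb{N}$, a $k$-cover of $G$ is a nonzero vector $\mathbf{a}=(a_1,\dots,a_n)\in\mathbb{N}^n$ such that $a_i+a_j\ge k$ for every edge $\{i,j\}$ of $G$. A $k$-cover is basic if it cannot be written as the (vertex-wise) sum of a $k$-cover and a $0$-cover (covers are nonzero by definition). $G$ is a domain if for all $s,t\in\mathbb{N}$, not both zero, the sum of any $s$ basic $1$-covers (repetitions allowed) and any $t$ basic $2$-covers (repetitions allowed) of $G$ is a basic $(s+2t)$-cover of $G$. $G$ satisfies WSC if $G$ has at least one edge, and for every non-isolated vertex $i$ there exists an edge $\{i,j\}$ of $G$ such that for all edges $\{i,i'\}$ and $\{j,j'\}$ of $G$, $\{i',j'\}$ is also an edge of $G$ (in particular $i'\neq j'$). *)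

(* Defs.v *)
From mathcomp Require Import all_boot all_order all_algebra.

Set Implicit Arguments.
Unset Strict Implicit.
Unset Printing Implicit Defensive.

Import GRing.Theory.
Local Open Scope ring_scope.

(* The vertices 1, ..., n are represented by the elements 0, ..., n-1 of
   'I_n. *)
Record sgraph (n : nat) := SGraph {
  edge :> rel 'I_n;
  edge_sym : symmetric edge;
  edge_irrefl : irreflexive edge
}.

Definition cover (n : nat) (G : sgraph n) (k : nat) (a : {ffun 'I_n -> nat}) :
    Prop :=
  a <> 0 /\ (forall i j : 'I_n, G i j -> (k <= a i + a j)%N).

Definition basic_cover (n : nat) (G : sgraph n) (k : nat)
    (a : {ffun 'I_n -> nat}) : Prop :=
  cover G k a /\
  ~ (exists b c : {ffun 'I_n -> nat},
       [/\ cover G k b, cover G 0 c & a = b + c]).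

Definition graph_domain (n : nat) (G : sgraph n) : Prop :=
  forall s t : nat, ~ (s = 0%N /\ t = 0%N) ->
  forall (b : 'I_s -> {ffun 'I_n -> nat}) (c : 'I_t -> {ffun 'I_n -> nat}),
    (forall p : 'I_s, basic_cover G 1 (b p)) ->
    (forall q : 'I_t, basic_cover G 2 (c q)) ->
    basic_cover G (s + 2 * t) (\sum_(p < s) b p + \sum_(q < t) c q).

Definition WSC (n : nat) (G : sgraph n) : Prop :=
  (exists i j : 'I_n, G i j) /\
  (forall i : 'I_n, (exists k : 'I_n, G i k) ->
     exists j : 'I_n, G i j /\
       (forall i' j' : 'I_n, G i i' -> G j j' -> G i' j')).

(* Main.v *)
Require Import Defs.
From mathcomp Require Import all_boot all_order all_algebra.
From mathcomp Require Import zify.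

(** Why the theorem holds.  Once G has an edge and [0 < k], removing one unit
    at a vertex i from a k-cover leaves a k-cover unless an edge at i blocks
    it, i.e. is tight: its two values add up to exactly k.  So a k-cover is
    basic iff every vertex of positive value lies on a tight edge
    ([basic_coverP]), and a sum of basic covers can only fail to be basic
    because its summands are not tight on a common edge.

    Call an edge {i, j} square if every neighbour of i is adjacent to every
    neighbour of j, as WSC asks.  A square edge is tight for all basic covers
    of positive order simultaneously ([square_edge_tight]): a basic cover b
    with [k < b i + b j] has edges {i, i'} and {j, j'} that are tight, and then
    [b i' + b j' = 2 * k - (b i + b j) < k] contradicts the edge {i', j'}.
    Under WSC every non-isolated vertex lies on a square edge, which is tight
    in each summand, hence in the sum.

    Conversely, suppose that no edge at the non-isolated vertex i is square.
    For each neighbour j of i there are non-adjacent, possibly equal, i' and j'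
    adjacent to i and j.  A minimal vertex cover avoiding i' and j' contains
    both i and j ([nonsquare_slack]), so it is a basic 1-cover slack on
    {i, j}.  The sum of such covers, one for each j, is slack on every edge
    at i and positive at i, so it is not basic; adding further basic 1-covers
    does no harm.  Minimal vertex covers alone
    therefore detect the failure of WSC. *)

Set Implicit Arguments.
Unset Strict Implicit.
Unset Printing Implicit Defensive.

Import GRing.Theory.
Local Open Scope ring_scope.

Definition unit_vector n (i : 'I_n) : {ffun 'I_n -> nat} :=
  [ffun x => nat_of_bool (x == i)].

Lemma unit_vector_neq0 n (i : 'I_n) : unit_vector i <> 0.
Proof. by move=> /ffunP /(_ i); rewrite !ffunE eqxx. Qed.

Lemma ffun_nat_pos n (a : {ffun 'I_n -> nat}) :
  a <> 0 -> exists i, (0 < a i)%N.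
Proof.
move=> a0; have [/existsP //|/existsPn az] := boolP [exists i, (0 < a i)%N].
case: a0; apply/ffunP => i; rewrite ffunE; move: (az i).
by rewrite lt0n negbK => /eqP.
Qed.

Lemma edge_cover_neq0 n (G : sgraph n) k (a : {ffun 'I_n -> nat}) :
  (0 < k)%N -> (exists i j, G i j) ->
  (forall i j, G i j -> (k <= a i + a j)%N) -> a <> 0.
Proof. by move=> k0 [i [j ij]] ca a0; move: (ca _ _ ij); rewrite a0 !ffunE; lia. Qed.

(** Basic covers are those in which no single entry can be decreased; this
    turns a statement about all decompositions into a local one.  The edge
    guarantees that the decreased vector stays nonzero, as covers must be. *)
Lemma basic_coverP n (G : sgraph n) k (a : {ffun 'I_n -> nat}) :
  (0 < k)%N -> (exists i j, G i j) ->
  basic_cover G k a <->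
  (forall i j, G i j -> (k <= a i + a j)%N) /\
  (forall i, (0 < a i)%N -> exists j, G i j /\ (a i + a j = k)%N).
Proof.
move=> k0 exG; split=> [[[_ ca] nodec]|[ca tight]].
  split=> // i ai0.
  have [/existsP [j /andP [ij /eqP aij]]|/existsPn slack] :=
    boolP [exists j, G i j && (a i + a j == k)%N]; first by exists j.
  case: nodec; pose b : {ffun 'I_n -> nat} := [ffun x => (a x - (x == i))%N].
  have cb x y : G x y -> (k <= b x + b y)%N.
    move=> xy; rewrite !ffunE; have := ca _ _ xy.
    case: (eqVneq x i) => [xi|_]; case: (eqVneq y i) => [yi|_] /=.
    - by move: xy; rewrite xi yi edge_irrefl.
    - by move: (slack y) ai0; rewrite -xi xy /= => /eqP; lia.
    - by move: (slack x) ai0; rewrite -yi edge_sym xy /= => /eqP; lia.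
    - by lia.
  exists b, (unit_vector i); split.
  - by split=> //; apply: edge_cover_neq0 cb.
  - by split=> //; apply: unit_vector_neq0.
  - apply/ffunP => x; rewrite !ffunE.
    by case: eqP => [->|_] /=; rewrite ?subn0 ?addr0 // -[RHS]/(_ + _)%N subnK.
split; first by split=> //; apply: edge_cover_neq0 ca.
move=> [b [c [[_ cb] [/ffun_nat_pos [i ci0] _] abc]]].
have abcE x : a x = (b x + c x)%N by rewrite abc ffunE.
have [|j [ij aij]] := tight i; first by rewrite abcE; lia.
by have := cb _ _ ij; rewrite !abcE in aij; lia.
Qed.

(** The three edges {i, i'}, {j, j'} and {i', j'} bound [b i + b j] from above:
    the first two can be taken tight, so the third limits the slack to zero. *)
Lemma square_edge_tight n (G : sgraph n) k (b : {ffun 'I_n -> nat}) i j :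
  (0 < k)%N -> G i j ->
  (forall i' j', G i i' -> G j j' -> G i' j') ->
  basic_cover G k b -> (b i + b j = k)%N.
Proof.
move=> k0 ij square /basic_coverP; case=> // [|cb tight]; first by exists i, j.
apply/eqP; rewrite eqn_leq cb // andbT leqNgt; apply/negP => slack.
(* Tightness at i and j needs positive values there; a zero value at one end
   would force a value above k at the other, which no edge can make tight. *)
have [bi0|bi0] := posnP (b i); have [bj0|bj0] := posnP (b j).
- by lia.
- by have [j' [_ ?]] := tight j bj0; lia.
- by have [i' [_ ?]] := tight i bi0; lia.
have [i' [ii' ti]] := tight i bi0; have [j' [jj' tj]] := tight j bj0.
by have := cb _ _ (square _ _ ii' jj'); lia.
Qed.

(** The complement of a maximal independent set is a minimal vertex cover;
    maximality provides the tight edges. *)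
Lemma basic_cover_avoiding n (G : sgraph n) (S : {set 'I_n}) :
  (exists i j, G i j) -> {in S &, forall x y, ~~ G x y} ->
  exists a, basic_cover G 1 a /\ {in S, forall x, a x = 0%N}.
Proof.
move=> exG indepS.
pose indep (A : {set 'I_n}) := [forall x in A, forall y in A, ~~ G x y].
have indepP (A : {set 'I_n}) : reflect {in A &, forall x y, ~~ G x y} (indep A).
  apply: (iffP forall_inP) => [h x y xA yA|h x xA].
    by have /forall_inP := h x xA; apply.
  by apply/forall_inP => y; apply: h.
have [M /maxsetP [/indepP indepM maxM] /subsetP SM] :=
  maxset_exists (introT (indepP S) indepS).
exists [ffun x => nat_of_bool (x \notin M)]; split; last first.
  by move=> x /SM xM; rewrite ffunE xM.
apply/basic_coverP => //; split=> [i j ij|i].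
  rewrite !ffunE; case: (boolP (i \in M)) => //= iM.
  by case: (boolP (j \in M)) => //= jM; move: (indepM _ _ iM jM); rewrite ij.
rewrite ffunE; case: (boolP (i \in M)) => //= iM _.
have [/exists_inP [j jM ij]|/exists_inPn noedge] := boolP [exists j in M, G i j].
  by exists j; rewrite ffunE jM.
case/negP: iM; rewrite -(maxM (i |: M)) ?setU11 ?subsetUr //.
apply/indepP => x y /setU1P [->|xM] /setU1P [->|yM].
- by rewrite edge_irrefl.
- exact: noedge.
- by rewrite edge_sym; apply: noedge.
- exact: indepM.
Qed.

(** A cover vanishing at i' and j' must be positive at their neighbours i
    and j.  The case [i' = j'] is a triangle, and works alike since a single
    vertex is independent. *)
Lemma nonsquare_slack n (G : sgraph n) i j i' j' :
  G i i' -> G j j' -> ~~ G i' j' ->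
  exists a, [/\ basic_cover G 1 a, (0 < a i)%N & (0 < a j)%N].
Proof.
move=> ii' jj' nij.
have exG : exists x y, G x y by exists i, i'.
have [|a [ba a0]] := @basic_cover_avoiding n G [set i'; j'] exG.
  by move=> x y /set2P [] -> /set2P [] ->; rewrite ?edge_irrefl // edge_sym.
exists a; split=> //; have [[_ ca] _] := ba.
- by have := ca _ _ ii'; rewrite (a0 i') ?set21 // addn0.
- by have := ca _ _ jj'; rewrite (a0 j') ?set22 // addn0.
Qed.

Lemma sum_coversE n s t (b : 'I_s -> {ffun 'I_n -> nat})
    (c : 'I_t -> {ffun 'I_n -> nat}) i :
  (\sum_(p < s) b p + \sum_(q < t) c q) i =
  (\sum_(p < s) b p i + \sum_(q < t) c q i)%N.
Proof. by rewrite ffunE !sum_ffunE. Qed.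

Lemma WSC_graph_domain n (G : sgraph n) : WSC G -> graph_domain G.
Proof.
move=> [exG wsc] s t st b c bb bc.
have st0 : (0 < s + 2 * t)%N.
  by rewrite lt0n; apply/eqP => st0; apply: st; lia.
pose a := \sum_(p < s) b p + \sum_(q < t) c q; rewrite -/a.
have sumE x y : (a x + a y =
    \sum_(p < s) (b p x + b p y) + \sum_(q < t) (c q x + c q y))%N.
  by rewrite !sum_coversE !big_split /= addnACA.
have constE : (s + 2 * t = \sum_(p < s) 1 + \sum_(q < t) 2)%N.
  by rewrite !sum_nat_const !card_ord muln1 mulnC.
apply/basic_coverP => //; split=> [i j ij|i].
  rewrite sumE constE leq_add // leq_sum // => p _.
    by have [[_ ->]] := bb p.
  by have [[_ ->]] := bc p.
move=> pos.
(* A positive entry of the sum comes from a positive entry of a summand, and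
   basic covers vanish at isolated vertices. *)
have nisol : exists k, G i k.
  have tight k (v : {ffun 'I_n -> nat}) :
      (0 < k)%N -> basic_cover G k v -> (0 < v i)%N -> exists j, G i j.
    by move=> k0 /basic_coverP - [] // _ h /h [j [ij _]]; exists j.
  have [/existsP [p bp]|/existsPn b0] := boolP [exists p, (0 < b p i)%N].
    exact: tight (bb p) bp.
  have [/existsP [q cq]|/existsPn c0] := boolP [exists q, (0 < c q i)%N].
    exact: tight (bc q) cq.
  move: pos; rewrite sum_coversE !big1 // => p _; apply/eqP.
    by move: (c0 p); rewrite lt0n negbK.
  by move: (b0 p); rewrite lt0n negbK.
have [j [ij square]] := wsc i nisol.
exists j; split=> //; rewrite sumE constE; congr (_ + _)%N.
  by apply: eq_bigr => p _; apply: square_edge_tight (bb p).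
by apply: eq_bigr => q _; apply: square_edge_tight (bc q).
Qed.

(** Without edges all nonzero vectors are covers of every order, so a unit
    vector e is basic, whereas e + e is visibly decomposable. *)
Lemma graph_domain_has_edge n (G : sgraph n) :
  (0 < n)%N -> graph_domain G -> exists i j, G i j.
Proof.
move=> n0 dom.
have [/existsP [i /existsP [j ij]]|/existsPn noedge] :=
  boolP [exists i, [exists j, G i j]]; first by exists i, j.
have cov k a : a <> 0 -> Defs.cover G k a.
  move=> a0; split=> // i j ij.
  by have /existsPn /(_ j) := noedge i; rewrite ij.
pose e := unit_vector (Ordinal n0).
have e0 : e <> 0 by apply: unit_vector_neq0.
have be : basic_cover G 1 e.
  split; first exact: cov.
  move=> [b [c [[/ffun_nat_pos [x bx] _] [/ffun_nat_pos [y cy] _] ebc]]].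
  have ebcE z : ((z == Ordinal n0) = b z + c z :> nat)%N.
    by have /ffunP /(_ z) := ebc; rewrite !ffunE.
  have := ebcE x; have := ebcE y.
  case: eqP => [yE|_]; case: eqP => [xE|_] /=; try lia.
  by rewrite xE in bx *; rewrite yE in cy *; lia.
have [|||_ []] := dom 2 0 _ (fun=> e) (fun=> e).
- by case.
- by [].
- by case.
- exists e, e; split; [exact: cov|exact: cov|].
  by rewrite big_ord0 addr0 !big_ord_recl big_ord0 addr0.
Qed.

Lemma graph_domain_WSC n (G : sgraph n) :
  (0 < n)%N -> graph_domain G -> WSC G.
Proof.
move=> n0 dom; have exG := graph_domain_has_edge n0 dom.
split=> // i [k ik].
have [/existsP [j /andP [ij /forallP sq]]|/existsPn nosq] := boolP
  [exists j, G i j && [forall i', [forall j', G i i' ==> G j j' ==> G i' j']]].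
  exists j; split=> // i' j' ii' jj'.
  by have /forallP /(_ j') := sq i'; rewrite ii' jj'.
(* The family is indexed by all vertices, with arbitrary basic 1-covers at
   the non-neighbours of i, so that its size is simply n. *)
have slack p : exists a : {ffun 'I_n -> nat},
    basic_cover G 1 a /\ (G i p -> (0 < a i)%N /\ (0 < a p)%N).
  have [ip|_] := boolP (G i p); last first.
    have [|a [ba _]] := @basic_cover_avoiding n G set0 exG; last by exists a.
    by move=> x y; rewrite inE.
  move: (nosq p); rewrite ip => /forallPn [i' /forallPn [j']].
  rewrite !negb_imply => /and3P [ii' pj' nij].
  by have [a [ba ai ap]] := nonsquare_slack ii' pj' nij; exists a.
have [a aP] := fin_all_exists slack.
have bsum : basic_cover G (n + 2 * 0)
    (\sum_(p < n) a p + \sum_(q < 0) (fun=> 0) q).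
  apply: dom => [[n_eq0 _]|p|[]//]; first by rewrite n_eq0 in n0.
  by have [] := aP p.
have sum_order0 : (0 < n + 2 * 0)%N by lia.
have [_ tight] := (basic_coverP _ sum_order0 exG).1 bsum.
have [|j [ij]] := tight i.
  have [_ /(_ ik) [aki _]] := aP k.
  by rewrite sum_coversE (bigD1 k) //=; lia.
rewrite !sum_coversE !big_ord0 !addn0 -big_split /= (bigD1 j) //=.
set others := (X in (_ + X)%N = _).
have others_ge : (n.-1 <= others)%N.
  have := cardC1 j; rewrite card_ord -sum1_card => <-.
  by apply: leq_sum => p _; have [[[_ ->]]] := aP p.
by have [_ /(_ ij) [aji ajj]] := aP j; lia.
Qed.

Theorem theorem1 (n : nat) (hn : (0 < n)%N) (G : sgraph n) :
  WSC G <-> graph_domain G.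
Proof. by split; [apply: WSC_graph_domain|apply: graph_domain_WSC]. Qed.
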